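(* Let $q, \ell, t$ be positive integers. The number of $t$-tail-heavy words of length $\ell$ and depth $q$ is at most $t\, q^{t}\, c_q^{\ell + \sqrt{\ell} + 10}$.
   Context: A word $w_1 \cdots w_\ell \in \{1,\dots,q\}^\ell$ is $t$-tail-heavy of depth $q$ if there exist $n > \sqrt{\ell}$ indices $i_1, \dots, i_n$, all greater than $\ell - t$, such that $w_{i_1} = \cdots = w_{i_n} = q$, and such that for all (not necessarily distinct) $x, y \leq \ell - t$ with $x + y \in \{i_1, \dots, i_n\}$ we have $w_x + w_y \geq q$. For $q \geq 1$, $c_q := \sqrt{\lfloor (q+2)^2/4 \rfloor}$. *)

(* Defs.v *)
From mathcomp Require Import all_boot.
From Stdlib Require Import Reals.

Set Implicit Arguments.
Unset Strict Implicit.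
Unset Printing Implicit Defensive.

(* A word w_1 ... w_l over {1,...,q} is encoded as w : {ffun 'I_l -> 'I_q};
   position p (1-based) is the ordinal p-1, and the letter at position j.+1
   has value (w j).+1 in {1,...,q}. *)

(* t-tail-heavy of depth q: there is a set I of positions (1-based position
   i.+1 for i in I) with #|I| > sqrt l (equivalently #|I|^2 > l, as #|I| is a
   natural number), all positions > l - t, all carrying letter q, and for all
   positions x, y <= l - t with x + y in I (as positions), w_x + w_y >= q. *)
Definition tail_heavy (q l t : nat) (w : {ffun 'I_l -> 'I_q}) : bool :=
  [exists I : {set 'I_l},
    [&& (l < #|I| ^ 2)%N,
        [forall i in I, ((l - t < i.+1)%N && ((w i).+1 == q))] &
        [forall x : 'I_l, forall y : 'I_l,
           ((x.+1 <= l - t)%N && (y.+1 <= l - t)%N &&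
            [exists i in I, (i.+1 == x.+1 + y.+1)%N])
           ==> (q <= (w x).+1 + (w y).+1)%N]]].

Definition c_q (q : nat) : R := sqrt (INR (((q + 2) ^ 2) %/ 4)%N).

Definition num_tail_heavy (q l t : nat) : nat :=
  #|[set w : {ffun 'I_l -> 'I_q} | tail_heavy t w]|.

(* Main.v *)
(** Fix [m = l - t], [C = floor((q+2)^2/4)] and a set [J] of [n > sqrt l] tail
    positions. The heads of length [m] compatible with [J] are the homomorphisms
    [f] with [f x + f y >= q] on the edges of the graph [x + y \in J]. Zhao's
    bipartite swapping trick bounds the square of their number by the number of
    homomorphisms of the bipartite double cover. Adding free vertices to one side
    of the cover makes all degrees on the other side equal to [n], and Finner's
    inequality bounds the [n]-th power of the count by a product over the enlarged
    side of complete-bipartite counts, each at most [q C^d q^(n-d)] at a vertex of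
    degree [d]. Hence there are at most [(C^m q^t)^(1/2) q^(l/2n)] heads. Encoding
    a word by its head and its tail with the positions of [J] marked gives at
    most [(q+1)^t] tails; for [q >= 3] the inequality [(q+1)^2 <= q C] closes the
    computation, and for [q <= 2] already [q <= c_q]. *)

From Stdlib Require Import Reals Lra.
From mathcomp Require Import all_boot all_order all_algebra.
From mathcomp Require Import zify.
Require Import Defs.

Set Implicit Arguments.
Unset Strict Implicit.
Unset Printing Implicit Defensive.

(** * Hoelder's inequality for finite sums *)

Section Hoelder.

Import Order.TTheory GRing.Theory Num.Theory.
Local Open Scope ring_scope.

(* Hoelder for [n] functions, with [z a] in place of [(P * \prod_v G v a)^(1/n)] so
   that no root appears. *)
Lemma hoelder_rootfree (F : realFieldType) (T V : finType) (N : {set V})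
    (P : F) (z : T -> F) (G : V -> T -> F) :
  N != set0 -> 0 <= P -> (forall a, 0 <= z a) -> (forall v a, 0 <= G v a) ->
  (forall v, v \in N -> 0 < \sum_a G v a) ->
  (forall a, z a ^+ #|N| <= P * \prod_(v in N) G v a) ->
  (\sum_a z a) ^+ #|N| <= P * \prod_(v in N) \sum_a G v a.
Proof.
move=> N0 P0 z0 G0 S0 zG; set n := #|N|; set K := P * _; set Z := \sum_a z a.
have n0 : (0 < n)%N by rewrite card_gt0.
have K0 : 0 <= K by rewrite mulr_ge0 ?prodr_ge0 // => v /S0/ltW.
have Z0 : 0 <= Z by rewrite sumr_ge0.
pose x v a := G v a / \sum_a G v a.
have x0 v a : 0 <= x v a by rewrite divr_ge0 ?sumr_ge0.
(* The average of the normalised [G v] has sum 1, and by AM-GM its [n]-th power dominates the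
   product of the [x v a]. *)
pose mu a := (\sum_(v in N) x v a) / n%:R.
have mu0 a : 0 <= mu a by rewrite divr_ge0 ?ler0n ?sumr_ge0.
have zK a : z a ^+ n <= K * mu a ^+ n.
  apply: (le_trans (zG a)).
  have -> : P * \prod_(v in N) G v a = K * \prod_(v in N) x v a.
    rewrite -mulrA -big_split /=; congr (_ * _); apply: eq_bigr => v /S0 Sv.
    by rewrite mulrC divfK ?gt_eqF.
  apply: ler_wpM2l => //.
  by apply: (leif_AGM (A := mem N) (E := x^~ a)).
have mu1 : \sum_a mu a = 1.
  rewrite -mulr_suml exchange_big /= (eq_bigr (fun=> 1)).
    by rewrite sumr_const -/n divff // pnatr_eq0 -lt0n.
  by move=> v /S0 Sv; rewrite -mulr_suml divff ?gt_eqF.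
(* If [K < Z ^+ n], then [z a <= Z * mu a] for all [a]. Both sides sum to [Z], so equality holds
   throughout, and a point with [0 < mu a] yields [Z ^+ n <= K]. *)
rewrite leNgt; apply/negP => KZ.
have zmu a : z a <= Z * mu a.
  have Zmu0 : 0 <= Z * mu a by exact: mulr_ge0.
  rewrite -(ler_pXn2r n0) ?nnegrE // exprMn.
  by apply: (le_trans (zK a)); rewrite ler_wpM2r ?exprn_ge0 // ltW.
have eq0 : \sum_a (Z * mu a - z a) = 0.
  by rewrite sumrB -mulr_sumr mu1 mulr1 subrr.
have {}eq0 a : Z * mu a = z a.
  apply/eqP; rewrite -subr_eq0; apply/eqP.
  by apply: (psumr_eq0P _ eq0) => // b _; rewrite subr_ge0.
have [a] : exists a, 0 < mu a.
  apply/existsP; apply: contraT; rewrite negb_exists => /forallP muN.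
  suff : \sum_a mu a = 0 by rewrite mu1 => /eqP; rewrite oner_eq0.
  by apply: big1 => a _; apply/eqP; rewrite eq_le mu0 leNgt muN.
move=> mua; have := zK a; rewrite -eq0 exprMn ler_pM2r ?exprn_gt0 //.
by rewrite leNgt KZ.
Qed.

Lemma hoelder_nat (T V : finType) (N : {set V}) (P : nat) (z : T -> nat)
    (G : V -> T -> nat) :
  N != set0 ->
  (forall a, z a ^ #|N| <= P * \prod_(v in N) G v a)%N ->
  ((\sum_a z a) ^ #|N| <= P * \prod_(v in N) \sum_a G v a)%N.
Proof.
move=> N0 zG; have n0 : (0 < #|N|)%N by rewrite card_gt0.
case: (boolP [forall v in N, (0 < \sum_a G v a)%N]) => [/forall_inP S0|].
  rewrite -(ler_nat rat) natrX natrM natr_prod natr_sum.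
  under [X in _ <= _ * X]eq_bigr do rewrite natr_sum.
  apply: hoelder_rootfree => // [v vN|a].
    by rewrite -natr_sum ltr0n S0.
  by rewrite -natr_prod -natrX -natrM ler_nat.
(* A [G v] with zero sum vanishes identically, which forces [z] to vanish. *)
case/forall_inPn => v vN; rewrite -eqn0Ngt sum_nat_eq0 => /forallP Gv.
rewrite big1 ?exp0n // => a _; apply/eqP; rewrite -[_ == _]andbT -n0 -expn_eq0 -leqn0.
by apply: leq_trans (zG a) _; rewrite (bigD1 v) //= (eqP (Gv a)) mul0n muln0.
Qed.

End Hoelder.

(** * Finner's inequality *)

Section Finner.

Variable T : finType.

Definition ffun_cons m (a : T) (F : {ffun 'I_m -> T}) : {ffun 'I_m.+1 -> T} :=
  [ffun x => if unlift ord0 x is Some y then F y else a].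

Lemma sum_ffun_cons m (f : {ffun 'I_m.+1 -> T} -> nat) :
  \sum_F f F = \sum_a \sum_F f (ffun_cons a F).
Proof.
rewrite pair_big /= (reindex (fun p : T * {ffun 'I_m -> T} => ffun_cons p.1 p.2)) //=.
exists (fun F => (F ord0, [ffun x => F (lift ord0 x)])) => [[a F] _|F _] /=.
  congr pair; first by rewrite ffunE unlift_none.
  by apply/ffunP => x; rewrite !ffunE liftK.
by apply/ffunP => x; rewrite ffunE; case: unliftP => [y|] ->; rewrite ?ffunE.
Qed.

(** Induction on the number of coordinates: slice at the first one, then apply Hoelder over its
    value. The factor at [v] is a combination of product functions, so summing out a coordinate acts
    inside the sum over [s]. *)
Lemma finner_nat (S V : finType) (n m : nat) (E : 'I_m -> {set V})
    (W : S -> T -> nat) (k : V -> S -> nat) (z : {ffun 'I_m -> T} -> nat) :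
  0 < n -> (forall x, #|E x| = n) ->
  (forall F, z F ^ n
     <= \prod_v \sum_s k v s * \prod_(x | v \in E x) W s (F x)) ->
  (\sum_F z F) ^ n
     <= \prod_v \sum_s k v s * (\sum_a W s a) ^ #|[set x | v \in E x]|.
Proof.
move=> n0; elim: m => [|m IH] in E k z *.
  move=> _ zk; have F0 : {ffun 'I_0 -> T} by apply: ffun0; rewrite card_ord.
  rewrite (big_pred1 F0) => [|F]; last by apply/esym/eqP/ffunP => -[].
  apply: leq_trans (zk F0) _; apply/eq_leq/eq_bigr => v _; apply: eq_bigr => s _.
  rewrite big_pred0 => [|[]//]; rewrite (_ : [set x | _] = set0) ?cards0 //.
  by apply/setP => -[].
move=> En zk; set N := E ord0.
pose d v := #|[set x | v \in E (lift ord0 x)]|.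
(* The contribution of the fixed first coordinate is absorbed into the coefficient. *)
pose g v s a := k v s * (if v \in N then W s a else 1).
have dE v : #|[set x | v \in E x]| = (v \in N) + d v.
  by rewrite /d -!sum1dep_card big_mkcond big_ord_recl -big_mkcond /N; case: (v \in _).
pose C s := \sum_a W s a.
rewrite sum_ffun_cons -(En ord0) -/N.
have step a : (\sum_F z (ffun_cons a F)) ^ #|N|
    <= (\prod_(v in ~: N) \sum_s k v s * C s ^ d v)
       * \prod_(v in N) \sum_s k v s * W s a * C s ^ d v.
  rewrite (En ord0).
  have := IH (fun x => E (lift ord0 x)) (fun v s => g v s a)
             (fun F => z (ffun_cons a F)) (fun x => En _).
  have -> : \prod_v \sum_s g v s a * C s ^ d v =
      (\prod_(v in ~: N) \sum_s k v s * C s ^ d v)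
       * \prod_(v in N) \sum_s k v s * W s a * C s ^ d v.
    rewrite (bigID (mem N)) /= mulnC; congr (_ * _).
      apply: eq_big => [v|v vN]; first by rewrite inE.
      by apply: eq_bigr => s _; rewrite /g (negPf vN) muln1.
    by apply: eq_bigr => v vN; apply: eq_bigr => s _; rewrite /g vN.
  apply => F; apply: leq_trans (zk _) _; apply/eq_leq/eq_bigr => v _.
  apply: eq_bigr => s _; rewrite -mulnA; congr (_ * _).
  rewrite big_mkcond big_ord_recl -big_mkcond ffunE unlift_none; congr (_ * _).
  by apply: eq_bigr => x _; rewrite ffunE liftK.
have N0 : N != set0 by rewrite -card_gt0 En.
apply: leq_trans (hoelder_nat N0 step) _; rewrite mulnC.
rewrite [leqRHS](bigID (mem N)) /=; apply/eq_leq; congr (_ * _).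
  apply: eq_bigr => v vN; rewrite exchange_big; apply: eq_bigr => s _.
  by rewrite dE vN add1n expnS -big_distrl -big_distrr mulnA.
apply: eq_big => [v|v]; rewrite inE // => vN.
by apply: eq_bigr => s _; rewrite dE (negPf vN) add0n.
Qed.

End Finner.

(** * Zhao's bipartite swapping trick *)

Section Swap.

Variables (X : finType) (q : nat) (e : rel X).

Implicit Types (f g : {ffun X -> 'I_q}) (p : {ffun X -> 'I_q} * {ffun X -> 'I_q}).

Definition heavy (a b : 'I_q) := q <= a.+1 + b.+1.

Definition homs :=
  [set f : {ffun X -> 'I_q} | [forall x, forall y, e x y ==> heavy (f x) (f y)]].

Definition bihoms :=
  [set p : {ffun X -> 'I_q} * {ffun X -> 'I_q} |
     [forall x, forall y, e x y ==> heavy (p.1 x) (p.2 y)]].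

Lemma homsP f :
  reflect (forall x y, e x y -> heavy (f x) (f y)) (f \in homs).
Proof.
rewrite inE; apply: (iffP forallP) => [fP x y exy|fP x].
  by have /forallP/(_ y)/implyP := fP x; apply.
by apply/forallP => y; apply/implyP; apply: fP.
Qed.

Lemma bihomsP p :
  reflect (forall x y, e x y -> heavy (p.1 x) (p.2 y)) (p \in bihoms).
Proof.
rewrite inE; apply: (iffP forallP) => [fP x y exy|fP x].
  by have /forallP/(_ y)/implyP := fP x; apply.
by apply/forallP => y; apply/implyP; apply: fP.
Qed.

Definition swap (A : {set X}) p : {ffun X -> 'I_q} * {ffun X -> 'I_q} :=
  ([ffun x => if x \in A then p.2 x else p.1 x],
   [ffun x => if x \in A then p.1 x else p.2 x]).

Definition clash p : {set X * X} :=
  [set xy | e xy.1 xy.2 &&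
     ~~ [&& heavy (p.1 xy.1) (p.1 xy.2), heavy (p.1 xy.1) (p.2 xy.2),
            heavy (p.2 xy.1) (p.1 xy.2) & heavy (p.2 xy.1) (p.2 xy.2)]].

Definition separates (A : {set X}) p :=
  [forall xy in clash p, (xy.1 \in A) != (xy.2 \in A)].

(* The choice depends only on [clash p], hence is invariant under [swap]. *)
Definition separator p : {set X} := odflt set0 [pick A | separates A p].

Lemma swapK A : involutive (swap A).
Proof.
by case=> f g; congr pair; apply/ffunP => x; rewrite !ffunE /=; case: (x \in A).
Qed.

Lemma clash_swap A p : clash (swap A p) = clash p.
Proof.
apply/setP => -[x y]; rewrite !inE /= !ffunE; congr (_ && ~~ _).
by case: (x \in A); case: (y \in A); apply/and4P/and4P => -[].
Qed.

Lemma separator_swap A p : separator (swap A p) = separator p.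
Proof.
by congr odflt; apply: eq_pick => B; rewrite /separates clash_swap.
Qed.

(* A violated cross sum [f x + g y < q] forces [f x < g x] and [g y < f y]. *)
Lemma separator_homs f g :
  f \in homs -> g \in homs -> separates (separator (f, g)) (f, g).
Proof.
move=> /homsP fP /homsP gP.
rewrite /separator; case: pickP => //= /(_ [set x | f x < g x])/idP[].
apply/forall_inP => -[x y]; rewrite !inE /= => /andP[exy].
have := fP x y exy; have := gP x y exy; rewrite /heavy; lia.
Qed.

(** Swapping along the separator is injective because the separator survives the swap. Edges
    crossing it then compare [f] with [f] or [g] with [g], and the other edges carry no clash. *)
Lemma card_homs_sqr : #|homs| ^ 2 <= #|bihoms|.
Proof.
have inj : injective (fun p => swap (separator p) p).
  by apply: inv_inj => p; rewrite separator_swap swapK.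
rewrite -mulnn -cardsX -(card_imset _ inj).
apply: subset_leq_card; apply/subsetP => p'.
case/imsetP=> -[f g]; rewrite inE => /andP[/= fP gP] ->.
have /forall_inP sep := separator_homs fP gP; set A := separator _ in sep *.
move/homsP in fP; move/homsP in gP; apply/bihomsP => x y exy; rewrite !ffunE.
have cl : (x \in A) = (y \in A) -> (x, y) \notin clash (f, g).
  by move=> Axy; apply/negP => /sep /=; rewrite Axy eqxx.
move: cl; rewrite inE exy /= negbK; have := fP x y exy; have := gP x y exy.
by case: (x \in A); case: (y \in A) => // _ _ /(_ erefl)/and4P[].
Qed.

End Swap.
Lemma leq_exp_base a b n : a <= b -> a ^ n <= b ^ n.
Proof. by case: n => // n; rewrite leq_exp2r. Qed.

Lemma sum_leq_ord q k : \sum_(a < q) (k <= a) = q - k.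
Proof.
elim: q => [|q IH]; first by rewrite big_ord0.
by rewrite big_ord_recr /= IH; case: leqP; lia.
Qed.

(** * Counting heads as homomorphisms of the sum graph *)

Section SumGraph.

Variables (q m t : nat) (J : {set 'I_t}).

(* 0-based positions: [x] and [v] stand for [x.+1] and [v.+1], and [j : 'I_t] for
   the tail position [(m + j).+1]. The second index ranges beyond ['I_m] so that
   every [nbr x] has exactly [#|J|] elements. *)
Definition nbr (x : 'I_m) : {set 'I_(m + t)} :=
  [set v : 'I_(m + t) | [exists j in J, m + j == x + v.+1]].

Definition edge : rel 'I_m := [rel x y | lshift t y \in nbr x].

(** Each [j] gives the single index [m + j - x.+1], where the subtraction is exact since [x < m]. *)
Lemma card_nbr x : #|nbr x| = #|J|.
Proof.
have lt_f (j : 'I_t) : m + j - x.+1 < m + t by have := ltn_ord j; lia.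
pose f j := Ordinal (lt_f j).
suff -> : nbr x = f @: J.
  rewrite card_imset // => i j /(congr1 val) /= eq_ij; apply: val_inj => /=.
  have := ltn_ord x; lia.
apply/setP => v; rewrite inE; apply/exists_inP/imsetP => -[j jJ vj]; exists j => //.
  apply: val_inj => /=; move/eqP: vj; lia.
rewrite vj /=; have := ltn_ord x; lia.
Qed.

Lemma card_conbr_leq v : #|[set x | v \in nbr x]| <= #|J|.
Proof.
set D := [set x | _]; rewrite 2!cardE -(size_map (fun x : 'I_m => x + v.+1)).
rewrite -[leqRHS](size_map (fun j : 'I_t => m + j)); apply: uniq_leq_size.
  by rewrite map_inj_uniq ?enum_uniq // => x y /addIn/val_inj.
move=> _ /mapP[x xD ->]; move: xD; rewrite mem_enum !inE => /exists_inP[j jJ /eqP <-].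
by apply/mapP; exists j; rewrite ?mem_enum.
Qed.

Lemma sum_card_conbr : \sum_v #|[set x | v \in nbr x]| = m * #|J|.
Proof.
under eq_bigr do rewrite -sum1dep_card big_mkcond.
rewrite exchange_big /= -[m in RHS]card_ord -sum_nat_const; apply: eq_bigr => x _.
by rewrite -big_mkcond sum1_card card_nbr.
Qed.

Hypothesis q_gt0 : 0 < q.

(** Only the smallest neighbouring value constrains [b]. Without neighbours, [q.-1] (the letter [q])
    imposes nothing. *)
Lemma exists_floor (F : {ffun 'I_m -> 'I_q}) v :
  exists2 s : 'I_q, forall x, v \in nbr x -> s <= F x &
    forall b, (forall x, v \in nbr x -> heavy (F x) b) -> heavy s b.
Proof.
case: (pickP (fun x => v \in nbr x)) => [x0 vx0|none].
  case: (@arg_minnP _ x0 (fun x => v \in nbr x) (fun x => F x : nat) vx0) => x vx xmin.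
  by exists (F x) => // b; apply.
have lt_q : q.-1 < q by lia.
exists (Ordinal lt_q) => [x|b _]; first by rewrite none.
rewrite /heavy /=; lia.
Qed.

Lemma card_heavy (s : 'I_q) : #|[set b | heavy s b]| = minn q s.+2.
Proof.
rewrite -sum1dep_card big_mkcond /=.
rewrite (eq_bigr (fun b : 'I_q => q - s.+2 <= b : nat)).
  rewrite sum_leq_ord; lia.
by move=> b _; rewrite /heavy; case: leqP; case: leqP; lia.
Qed.

(** Summing over all thresholds [s] below the neighbouring values, instead of taking their minimum,
    gives the form that [finner_nat] requires, at the cost of a later factor [q]. *)
Definition majorant (F : {ffun 'I_m -> 'I_q}) v :=
  \sum_(s < q) minn q s.+2 ^ #|J| * \prod_(x | v \in nbr x) (s <= F x : nat).

Lemma leq_majorant (F : {ffun 'I_m -> 'I_q}) v (B : {set 'I_q}) :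
  (forall b x, b \in B -> v \in nbr x -> heavy (F x) b) ->
  #|B| ^ #|J| <= majorant F v.
Proof.
move=> BF; have [s sF sb] := exists_floor F v.
rewrite /majorant (bigD1 s) //= [X in _ * X]big1 => [|x vx]; last by rewrite sF.
rewrite muln1; apply: leq_trans (leq_addr _ _).
have leB : #|B| <= minn q s.+2.
  rewrite -card_heavy; apply/subset_leq_card/subsetP => b bB.
  by rewrite inE; apply: sb => x; apply: BF.
exact: leq_exp_base.
Qed.

Lemma majorant_gt0 (F : {ffun 'I_m -> 'I_q}) v : 0 < majorant F v.
Proof.
have lt_q : q.-1 < q by lia.
rewrite -(exp1n #|J|) -(cards1 (Ordinal lt_q)); apply: leq_majorant => b x.
rewrite inE => /eqP -> _; rewrite /heavy /=; lia.
Qed.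

Lemma leq_prod_majorant (F : {ffun 'I_m -> 'I_q}) :
  #|[set G | (F, G) \in bihoms q edge]| ^ #|J| <= \prod_v majorant F v.
Proof.
pose B (y : 'I_m) := [set b | [forall x, edge x y ==> heavy (F x) b]].
apply: (@leq_trans ((\prod_y #|B y|) ^ #|J|)).
  have le_card : #|[set G | (F, G) \in bihoms q edge]| <= \prod_y #|B y|.
    have -> : \prod_y #|B y| = #|family (fun y => mem (B y))|.
      by rewrite card_family foldrE big_map big_enum.
    apply/subset_leq_card/subsetP => G; rewrite inE => /bihomsP FG.
    apply/familyP => y; rewrite inE; apply/forallP => x; apply/implyP.
    exact: FG.
  exact: leq_exp_base.
rewrite (big_morph (expn^~ #|J|) (fun a b => expnMn a b _) (exp1n _)).
(* The added vertices [v >= m] contribute factors at least 1. *)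
rewrite big_split_ord /= -[leqLHS]muln1; apply: leq_mul.
  apply: leq_prod => y _; apply: leq_majorant => b x; rewrite inE.
  by move=> /forallP/(_ x)/implyP.
by apply: prodn_gt0 => v; apply: majorant_gt0.
Qed.

Lemma card_bihoms_leq : J != set0 ->
  #|bihoms q edge| ^ #|J|
    <= q ^ (m + t) * (((q + 2) ^ 2 %/ 4) ^ m * q ^ t) ^ #|J|.
Proof.
move=> J0; set C := _ %/ 4; set n := #|J|.
have n0 : 0 < n by rewrite card_gt0.
have -> : #|bihoms q edge| = \sum_F #|[set G | (F, G) \in bihoms q edge]|.
  under eq_bigr do rewrite -sum1dep_card.
  by rewrite pair_big_dep /= -sum1_card; apply: eq_bigl => -[].
apply: leq_trans (finner_nat (W := fun s a : 'I_q => s <= a : nat)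
  n0 card_nbr leq_prod_majorant) _.
pose d v := #|[set x | v \in nbr x]|.
apply: (@leq_trans (\prod_v (q * (C ^ d v * q ^ (n - d v))))).
  apply: leq_prod => v _; rewrite -[X in _ <= X * _]card_ord -sum_nat_const.
  apply: leq_sum => s _; rewrite sum_leq_ord -/(d v) -/n.
  (* Of the [n] factors [minn q s.+2], [d v] are paired with factors [q - s]; the other [n - d v]
     are bounded by [q]. *)
  rewrite -[n in leqLHS](subnKC (card_conbr_leq v)) expnD mulnAC -expnMn.
  apply: leq_mul; apply: leq_exp_base.
    (* As [s.+2] and [q - s] sum to [q + 2], AM-GM bounds their product by [C]. *)
    rewrite /C; have -> : q + 2 = s.+2 + (q - s) by have := ltn_ord s; lia.
    rewrite leq_divRL // mulnC; apply: leq_trans (nat_AGM2 _ _).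
    by rewrite leq_mul2l leq_mul2r geq_minr orbT.
  exact: geq_minl.
(* The degrees sum to [m * n], so the deficits [n - d v] sum to [t * n]. *)
rewrite !big_split /= prod_nat_const card_ord -!expn_sum sum_card_conbr sumnB.
  rewrite sum_card_conbr sum_nat_const card_ord -mulnBl addKn.
  by rewrite expnMn -!expnM.
by move=> v _; apply: card_conbr_leq.
Qed.

Lemma card_homs_leq : J != set0 ->
  (#|homs q edge| ^ 2) ^ #|J|
    <= q ^ (m + t) * (((q + 2) ^ 2 %/ 4) ^ m * q ^ t) ^ #|J|.
Proof.
move=> J0; apply: leq_trans (card_bihoms_leq J0).
by apply: leq_exp_base; apply: card_homs_sqr.
Qed.

End SumGraph.

(** * Encoding words by a marked tail and a head *)

Section Counting.

Variables (q m t : nat).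

Implicit Type w : {ffun 'I_(m + t) -> 'I_q}.

(* Taking all admissible positions makes the set in [tail_heavy] a function of [w]. *)
Definition full_tail w : {set 'I_t} :=
  [set j | ((w (rshift m j)).+1 == q) &&
     [forall x : 'I_m, forall y : 'I_m,
        (m + j == x + y.+1) ==> heavy (w (lshift t x)) (w (lshift t y))]].

(** A marked letter is known to be [q], so [None] can replace it without loss, and the marks recover
    [full_tail w]. *)
Definition tail_code w : {ffun 'I_t -> option 'I_q} :=
  [ffun j => if j \in full_tail w then None else Some (w (rshift m j))].

Definition word_code w := (tail_code w, [ffun x : 'I_m => w (lshift t x)]).

Lemma word_code_inj : injective word_code.
Proof.
move=> w w' [/ffunP eq_tail /ffunP eq_head]; apply/ffunP => i.
rewrite -(splitK i); case: (split i) => k /=.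
  by have := eq_head k; rewrite !ffunE.
have := eq_tail k; rewrite !ffunE.
case: ifP => wk; case: ifP => wk' //; last by case.
move: wk wk'; rewrite !inE => /andP[/eqP wq _] /andP[/eqP wq' _] _.
by apply: val_inj; apply: succn_inj; rewrite wq wq'.
Qed.

Lemma full_tail_code w : [set j | tail_code w j == None] = full_tail w.
Proof. by apply/setP => j; rewrite inE ffunE; case: ifP. Qed.

Lemma head_homs w :
  [ffun x => w (lshift t x)] \in homs q (@edge m t (full_tail w)).
Proof.
apply/homsP => x y; rewrite /edge /= inE !ffunE => /exists_inP[j].
by rewrite inE => /andP[_ /forallP/(_ x)/forallP/(_ y)/implyP].
Qed.

(** The definitions of [tail_heavy] and [c_q] use the Stdlib power. *)
Lemma Nat_powE a b : Nat.pow a b = a ^ b.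
Proof. by elim: b => //= b ->; rewrite expnS. Qed.

Lemma tail_heavy_full_tail w : tail_heavy t w -> m + t < #|full_tail w| ^ 2.
Proof.
case/existsP => I /and3P[]; rewrite Nat_powE addnK => lI /forall_inP Iq.
move=> /forallP Ixy; apply: leq_trans lI _; rewrite leq_exp2r //.
rewrite -(card_imset (full_tail w) (@rshift_inj m t)).
apply/subset_leq_card/subsetP => i iI; have /andP[mi wi] := Iq i iI.
have := iI; rewrite -(splitK i); case: (splitP i) => j ij.
  by have := ltn_ord j; lia.
rewrite /= => jI; apply: imset_f; rewrite inE.
have ji : rshift m j = i by apply: val_inj.
rewrite ji wi; apply/forallP => x; apply/forallP => y; apply/implyP => /eqP jxy.
have /forallP/(_ (lshift t y))/implyP := Ixy (lshift t x); apply.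
rewrite /= !ltn_ord; apply/exists_inP; exists i => //.
rewrite ij; lia.
Qed.

Lemma num_tail_heavy_leq :
  num_tail_heavy q (m + t) t <=
    q.+1 ^ t * \max_(J : {set 'I_t} | m + t < #|J| ^ 2) #|homs q (@edge m t J)|.
Proof.
set M := \max_(J | _) _; rewrite /num_tail_heavy -(card_imset _ word_code_inj).
pose J (u : {ffun 'I_t -> option 'I_q}) := [set j | u j == None].
(* Tails with too few marks admit no head. *)
pose P u := if m + t < #|J u| ^ 2 then homs q (@edge m t (J u)) else set0.
apply: (@leq_trans (\sum_u #|P u|)).
  under eq_bigr do rewrite -sum1_card.
  rewrite pair_big_dep /= sum1dep_card; apply: subset_leq_card.
  apply/subsetP => c /imsetP[w].
  rewrite !inE => /tail_heavy_full_tail hw ->.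
  by rewrite /= /P /J full_tail_code hw head_homs.
have -> : q.+1 ^ t = #|{ffun 'I_t -> option 'I_q}|.
  by rewrite card_ffun card_option !card_ord.
rewrite -sum_nat_const; apply: leq_sum => u _; rewrite /P.
case: ifP => [hu|_]; last by rewrite cards0.
by rewrite /M (bigD1 (J u)) //= leq_maxl.
Qed.

End Counting.

(** * Assembling the bounds and passing to real exponents *)

Lemma num_tail_heavy_trivial q l t : num_tail_heavy q l t <= q ^ l.
Proof. by apply: leq_trans (max_card _) _; rewrite card_ffun !card_ord. Qed.

Lemma num_tail_heavy_sqr q m t : 2 < q -> exists2 n, m + t < n ^ 2 &
  (num_tail_heavy q (m + t) t ^ 2) ^ n
    <= q ^ (m + t) * ((q ^ t) ^ 2 * ((q + 2) ^ 2 %/ 4) ^ (m + t)) ^ n.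
Proof.
move=> q_gt2; set C := _ %/ 4.
have := num_tail_heavy_leq q m t.
(* If no [J] is large enough, the maximum is empty and equals 0. *)
case: (pickP (fun J : {set 'I_t} => m + t < #|J| ^ 2)) => [J0 J0P|none]; last first.
  rewrite big_pred0 // muln0 leqn0 => /eqP ->.
  by exists (m + t).+1; rewrite ?exp0n //; nia.
rewrite (bigmax_eq_arg _ J0P); case: arg_maxnP => // J JP _ leN.
exists #|J| => //; have q_gt0 : 0 < q by lia.
have J_neq0 : J != set0 by rewrite -card_gt0; lia.
(* True from [q = 3] on; at [q = 2] it would read [9 <= 8]. *)
have qC : q.+1 ^ 2 <= q * C.
  have := divn_eq ((q + 2) ^ 2) 4; have := ltn_pmod ((q + 2) ^ 2) (isT : 0 < 4).
  rewrite -/C; nia.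
apply: leq_trans (leq_exp_base _ (leq_exp_base 2 leN)) _.
have qCt : (q.+1 ^ t) ^ 2 <= (q * C) ^ t by rewrite expnAC leq_exp_base.
rewrite (expnMn _ _ 2) (expnMn _ _ #|J|).
apply: leq_trans (leq_mul (leq_exp_base _ qCt) (leqnn _)) _.
apply: leq_trans (leq_mul (leqnn _) (card_homs_leq m q_gt0 J_neq0)) _.
rewrite -/C mulnCA -expnMn; apply/eq_leq; congr (_ * _ ^ _).
by rewrite expnMn expnD -mulnn; nia.
Qed.

(* After [all_algebra] the key [R] denotes [ring_scope]. *)
Delimit Scope R_scope with R.

Lemma INR_expn a b : INR (a ^ b) = (INR a ^ b)%R.
Proof. by rewrite -Nat_powE pow_INR. Qed.

Lemma INR_muln a b : INR (a * b) = (INR a * INR b)%R.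
Proof. by rewrite -mult_INR. Qed.

Lemma INR_leq a b : a <= b -> (INR a <= INR b)%R.
Proof. by move/leP/le_INR. Qed.

Lemma pow_le_inv (x y : R) n : 0 < n -> (0 <= y)%R -> (x ^ n <= y ^ n)%R -> (x <= y)%R.
Proof.
move=> n_gt0 y_ge0 xy; apply: Rnot_lt_le => lt_yx; apply: (Rle_not_lt _ _ xy).
case: n n_gt0 {xy} => // n _; elim: n => [|n IH]; first by rewrite !pow_1.
rewrite -!(tech_pow_Rmult _ n.+1); apply: Rmult_le_0_lt_compat => //.
exact: pow_le.
Qed.

Lemma c_q_sqr q : (c_q q ^ 2 = INR ((q + 2) ^ 2 %/ 4))%R.
Proof. by rewrite /c_q Nat_powE pow2_sqrt //; apply: pos_INR. Qed.

Lemma c_q_ge1 q : (1 <= c_q q)%R.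
Proof.
rewrite /c_q -[X in (X <= _)%R]sqrt_1; apply: sqrt_le_1_alt.
apply: (INR_leq (a := 1)); rewrite Nat_powE leq_divRL //; nia.
Qed.

Lemma q_leq_c_q_sqr q : q <= (q + 2) ^ 2 %/ 4.
Proof. rewrite leq_divRL //; nia. Qed.

Lemma pow_Rpower_le (c : R) l s :
  (1 <= c)%R -> (INR l <= s)%R -> (c ^ l <= Rpower c s)%R.
Proof.
move=> c1 ls; rewrite -Rpower_pow; last by lra.
by apply: Rle_Rpower.
Qed.

Lemma num_tail_heavy_le_Rpower q l t : 0 < q ->
  (INR (num_tail_heavy q l t)
   <= INR q ^ t * Rpower (c_q q) (INR l + sqrt (INR l)))%R.
Proof.
move=> q_gt0; set c := c_q q; set N := num_tail_heavy q l t.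
have c1 : (1 <= c)%R := c_q_ge1 q.
have q1 : (1 <= INR q)%R by apply: (INR_leq (a := 1)).
have sl : (0 <= sqrt (INR l))%R := sqrt_pos _.
have cl : (c ^ l <= Rpower c (INR l + sqrt (INR l)))%R.
  apply: pow_Rpower_le => //; lra.
have trivial : (INR q ^ l <= INR q ^ t * c ^ l)%R ->
    (INR N <= INR q ^ t * Rpower c (INR l + sqrt (INR l)))%R.
  move=> ql; have := INR_leq (num_tail_heavy_trivial q l t); rewrite INR_expn => Nq.
  apply: (Rle_trans _ _ _ Nq); apply: (Rle_trans _ _ _ ql).
  by apply: Rmult_le_compat_l cl; apply: pow_le; lra.
have [le_lt|lt_tl] := leqP l t.
  apply: trivial; rewrite -[X in (X <= _)%R]Rmult_1_r.
  apply: Rmult_le_compat; [apply: pow_le; lra|lra| |exact: pow_R1_Rle].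
  by apply: Rle_pow => //; apply/leP.
have [le_q2|q_gt2] := leqP q 2.
  (* For [q <= 2] one has [q <= c_q q], with equality at [q = 2]. *)
  apply: trivial; rewrite -[X in (X <= _)%R]Rmult_1_l.
  apply: Rmult_le_compat; [lra|apply: pow_le; lra|exact: pow_R1_Rle|].
  apply: pow_incr; split; first lra.
  apply: (pow_le_inv (n := 2)) => //; first lra.
  rewrite c_q_sqr -INR_expn; apply: INR_leq; rewrite leq_divRL //; nia.
have [m def_l] : exists m, l = m + t by exists (l - t); lia.
have [n ln] := num_tail_heavy_sqr m t q_gt2.
rewrite -def_l -/N in ln *; move/INR_leq.
rewrite !(INR_muln, INR_expn) -c_q_sqr -/c => leN.
have n_gt0 : 0 < n by case: n ln {leN}.
set r := Rpower c (sqrt (INR l)).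
have r0 : (0 < r)%R by apply: exp_pos.
(* Since [q <= c ^ 2] and [l = sqrt l * sqrt l <= n * sqrt l], the factor [q ^ l] becomes the extra
   [sqrt l] in the exponent of [c]. *)
have qr : (INR q ^ l <= (r ^ 2) ^ n)%R.
  apply: (@Rle_trans _ ((c ^ 2) ^ l)).
    apply: pow_incr; split; first lra.
    by rewrite c_q_sqr; apply/INR_leq/q_leq_c_q_sqr.
  rewrite -!pow_mult -[X in (_ <= X)%R]Rpower_pow // Rpower_mult.
  apply: pow_Rpower_le => //; rewrite !mult_INR.
  have sln : (sqrt (INR l) <= INR n)%R.
    rewrite -[INR n]sqrt_pow2; last exact: pos_INR.
    by apply: sqrt_le_1_alt; rewrite -INR_expn; apply/INR_leq/ltnW.
  have := sqrt_sqrt _ (pos_INR l); rewrite /=; nra.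
have leN2 : (INR N ^ 2 <= (INR q ^ t * (c ^ l * r)) ^ 2)%R.
  have qt0 : (0 < INR q ^ t)%R by apply: pow_lt; lra.
  apply: (pow_le_inv n_gt0); first exact: pow2_ge_0.
  apply: (Rle_trans _ _ _ leN).
  have -> : ((INR q ^ t * (c ^ l * r)) ^ 2 = r ^ 2 * ((INR q ^ t) ^ 2 * (c ^ 2) ^ l))%R.
    have -> : ((c ^ 2) ^ l = (c ^ l) ^ 2)%R by rewrite -!pow_mult Nat.mul_comm.
    ring.
  rewrite (Rpow_mult_distr (r ^ 2)); apply: Rmult_le_compat_r qr.
  by apply/pow_le/Rmult_le_pos; [exact: pow2_ge_0|do 2!apply: pow_le; lra].
rewrite Rpower_plus Rpower_pow; last lra.
apply: (pow_le_inv (n := 2)) leN2 => //.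
by apply: Rmult_le_pos; [|apply: Rmult_le_pos]; try apply: pow_le; lra.
Qed.

Theorem theorem3p7 (q l t : nat) (hq : (0 < q)%N) (hl : (0 < l)%N) (ht : (0 < t)%N) :
  (INR (num_tail_heavy q l t)
   <= INR t * INR q ^ t * Rpower (c_q q) (INR l + sqrt (INR l) + 10))%R.
Proof.
apply: (Rle_trans _ _ _ (num_tail_heavy_le_Rpower l t hq)).
have t1 : (1 <= INR t)%R by apply: (INR_leq (a := 1)).
have q0 : (0 <= INR q ^ t)%R by apply/pow_le/pos_INR.
apply: Rmult_le_compat => //; first exact/Rlt_le/exp_pos.
  by rewrite -[X in (X <= _)%R]Rmult_1_l; apply: Rmult_le_compat_r.
by apply: Rle_Rpower; [exact: c_q_ge1 | lra].
Qed.
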